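(* Let $a_1,\dots,a_n$ be nonzero integers and assume the equation $$a_1x_1+a_2x_2+\cdots+a_nx_n=0$$ is $r$-regular. Then it is strongly $r$-regular: for every finite collection of inequalities $$A_{j,1}x_1+A_{j,2}x_2+\cdots+A_{j,n}x_n\neq 0,\qquad 1\le j\le k,\ A_{j,i}\in\mathbb{Z},$$ none of which is a multiple of the equation (i.e. for no $j$ is $(A_{j,1},\dots,A_{j,n})$ a scalar multiple of $(a_1,\dots,a_n)$), and for every coloring of the positive integers with $r$ colors, there exist positive integers $x_1,\dots,x_n$, all of the same color, satisfying the equation and all $k$ inequalities.
   Context: For a positive integer $r$, a linear homogeneous equation $a_1x_1+\cdots+a_nx_n=0$ with nonzero integer coefficients (or a system of such an equation together with inequalities) is called $r$-regular if for every coloring of the positive integers with $r$ colors there exist positive integers $x_1,\dots,x_n$, all of the same color, satisfying the equation (and the inequalities). The equation is strongly $r$-regular if, whenever finitely many inequalities of the form $A_{j,1}x_1+\cdots+A_{j,n}x_n\neq0$ with integer coefficients, none a multiple of the equation, are added, the resulting system is still $r$-regular. *)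

(* Defs.v *)
From mathcomp Require Import all_boot all_order all_algebra.
Set Implicit Arguments. Unset Strict Implicit. Unset Printing Implicit Defensive.
Import Order.TTheory GRing.Theory Num.Theory.
Local Open Scope ring_scope.

(* A coloring of the positive integers with r colors: c : nat -> 'I_r
   (its value at 0 is irrelevant).  Solutions x : 'I_n -> nat with all
   x i > 0. *)

Definition lform (n : nat) (a : 'I_n -> int) (x : 'I_n -> nat) : int :=
  \sum_(i < n) a i * (x i)%:Z.

Definition monochromatic (n r : nat) (c : nat -> 'I_r) (x : 'I_n -> nat) :=
  exists col : 'I_r, forall i : 'I_n, c (x i) = col.

Definition regular_sys (n r k : nat) (a : 'I_n -> int) (A : 'I_k -> 'I_n -> int) :=
  forall c : nat -> 'I_r, exists x : 'I_n -> nat,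
    (forall i, (0 < x i)%N) /\ monochromatic c x /\
    lform a x = 0 /\ (forall j : 'I_k, lform (A j) x <> 0).

Definition r_regular (n r : nat) (a : 'I_n -> int) :=
  forall c : nat -> 'I_r, exists x : 'I_n -> nat,
    (forall i, (0 < x i)%N) /\ monochromatic c x /\ lform a x = 0.

Definition is_multiple (n : nat) (v a : 'I_n -> int) :=
  exists lam : rat, forall i, (v i)%:~R = lam * (a i)%:~R :> rat.

(* Main.v *)
(** A compactness argument gives an [N] such that every [r]-coloring of
    [1, ..., N] has a monochromatic solution.  Color each positive integer [m]
    by the pattern [(c (i * m))] for [i <= N].  By van der Waerden's theorem a
    long progression [D + j * e], [|j| <= L], has a constant pattern, and that
    pattern contains a monochromatic solution [x], so that every
    [y i = x i * (D + j i * e)] has the same color.  Fix an integer vector [v]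
    in the kernel of the equation on which none of the forms [A j] vanishes.
    Since [x i] divides [N!], one may take [j i = t * (N! / x i) * v i], that
    is [y = D * x + t * e * N! * v], which solves the equation for every [t];
    each form [A j] vanishes at [y] for at most one [t], so one of the values
    [t = 0, ..., k] works. *)

Require Import Defs.
From mathcomp Require Import all_boot all_order all_algebra.
From mathcomp Require Import boolp zify ring.
Set Implicit Arguments.
Unset Strict Implicit.
Unset Printing Implicit Defensive.
Import Order.TTheory GRing.Theory Num.Theory.
Local Open Scope ring_scope.

Section VanDerWaerden.
Local Open Scope nat_scope.

(* The bound leaves room for one more term of the progression. *)
Definition has_ap (F : finType) (L N : nat) (c : nat -> F) :=
  exists a d, [/\ 0 < d, a + L * d < N & forall j, j < L -> c (a + j * d) = c a].

(** Spokes of length [L] with common focus [f] at their lower end. Indexing them by their colors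
    makes the colors distinct, so [s] counts colors. *)
Definition has_fan (F : finType) (L N s : nat) (c : nat -> F) :=
  exists f (S : {set F}), [/\ f < N, #|S| = s &
    forall k, k \in S -> exists d, [/\ 0 < d, f + L.+1 * d < N &
      forall j, 0 < j <= L -> c (f + j * d) = k]].

Lemma has_ap_shift (F : finType) L N N' b (c : nat -> F) :
  b + N <= N' -> has_ap L N (fun i => c (b + i)) -> has_ap L N' c.
Proof.
move=> le_N [a [d [d_gt0 ltN ac]]]; exists (b + a), d; split=> //; first by lia.
by move=> j ltj; rewrite -addnA ac.
Qed.

Lemma fan_ap (F : finType) L N f d (c : nat -> F) :
  0 < d -> f + L.+1 * d < N ->
  (forall j, 0 < j <= L -> c (f + j * d) = c f) -> has_ap L.+1 N c.
Proof.
move=> d_gt0 ltN fc; exists f, d; split=> // -[|j] ltj; last exact: fc.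
by rewrite addn0.
Qed.

(* Color focusing: equally colored windows at [B + e, ..., B + L * e] add the
   step [e] to every spoke of a fan inside the window, and create a new spoke
   of step [e] in the color of the focus, which moves back to [B + f]. *)
Lemma fan_step (F : finType) L : 0 < L ->
  (forall G : finType, exists N, forall c : nat -> G, has_ap L N c) ->
  forall s, exists N, forall c : nat -> F, has_ap L.+1 N c \/ has_fan L N s c.
Proof.
move=> L_gt0 apL; elim=> [|s [N1 IHs]].
  exists 1 => c; right; exists 0, set0; split=> //; first by rewrite cards0.
  by move=> k; rewrite inE.
have [M apM] := apL {ffun 'I_N1 -> F}; exists (N1 + 2 * M) => c.
have [a [e [e_gt0 ltM ape]]] := apM (fun b => [ffun i : 'I_N1 => c (b + M + i)]).
have le_eM : e <= L * e by rewrite leq_pmull.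
(* One step before the progression of windows. Starting the windows at offset [M > e] keeps this
   subtraction from truncating. *)
pose B := a + M - e; pose c' i := c (B + e + i).
have windows j i : 0 < j <= L -> i < N1 -> c (B + j * e + i) = c' i.
  case: j => // j ltj lti; have /ffunP/(_ (Ordinal lti)) := ape j ltj.
  rewrite !ffunE /= /c' => cE.
  have -> : B + j.+1 * e + i = a + j * e + M + i by rewrite /B; lia.
  by rewrite cE; congr c; rewrite /B; lia.
have shift : has_ap L.+1 N1 c' -> has_ap L.+1 (N1 + 2 * M) c.
  by apply: has_ap_shift; rewrite /B; lia.
have [/shift|[f [S [ltf cardS fanS]]]] := IHs c'; first by left.
have [c'fS|c'fNS] := boolP (c' f \in S).
  left; apply: shift; have [d [d_gt0 ltN dc]] := fanS _ c'fS.
  exact: fan_ap d_gt0 ltN dc.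
right; exists (B + f), (c' f |: S); split; first by rewrite /B; lia.
  by rewrite cardsU1 c'fNS cardS.
move=> k; rewrite in_setU1 => /predU1P[->|/fanS[d [d_gt0 ltN dc]]].
  exists e; split=> //; first by rewrite /B; lia.
  by move=> j ltj; rewrite -(windows j f) //; congr c; lia.
exists (d + e); split; [lia|rewrite /B; lia|move=> j ltj].
rewrite -(dc j ltj) -(windows j) //; first by congr c; lia.
apply: leq_ltn_trans ltN; rewrite leq_add2l leq_mul2r; lia.
Qed.

(** A fan with [#|F|] spokes shows every color, so the focus extends the spoke of its own color. *)
Lemma van_der_Waerden L (F : finType) :
  exists N, forall c : nat -> F, has_ap L.+1 N c.
Proof.
elim: L F => [|L IHL] F.
  exists 2 => c; exists 0, 1; split=> // j; rewrite ltnS leqn0 => /eqP-> //.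
have [N apN] := @fan_step F L.+1 isT IHL #|F|; exists N => c.
have [//|[f [S [ltf cardS fanS]]]] := apN c.
have [|d [d_gt0 ltN dc]] := fanS (c f).
  suff -> : S = setT by [].
  by apply/eqP; rewrite eqEcard subsetT cardsT cardS leqnn.
exact: fan_ap d_gt0 ltN dc.
Qed.

End VanDerWaerden.

Section Compactness.
Local Open Scope nat_scope.

Definition unbounded (P : nat -> Prop) := forall M, exists2 N, M <= N & P N.

Lemma unbounded_color (F : finType) (P : nat -> Prop) (h : nat -> F) :
  unbounded P -> exists f, unbounded (fun N => P N /\ h N = f).
Proof.
move=> infP; apply: contrapT => nof.
have /choice[M MP] f : exists M, forall N, M <= N -> P N -> h N <> f.
  apply: contrapT => noM; apply: nof; exists f => M.
  apply: contrapT => noN; apply: noM; exists M => N leN PN hN.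
  by apply: noN; exists N.
have [N leN PN] := infP (\max_f M f).
by apply: (MP (h N) N _ PN) => //; apply: leq_trans leN; apply: leq_bigmax.
Qed.

Lemma coloring_compactness (F : finType) (u : nat -> nat -> F) :
  exists c, forall m, exists2 N, m <= N & forall i, i < m -> u N i = c i.
Proof.
have /choice[step stepP] (mP : nat * (nat -> Prop)) : exists f, unbounded mP.2 ->
    unbounded (fun N => mP.2 N /\ u N mP.1 = f).
  have [infP|] := pselect (unbounded mP.2); last by exists (u 0 0).
  by have [f] := unbounded_color (u^~ mP.1) infP; exists f.
(* [Q m] selects the [N] for which [u N] agrees with the limit below [m]; [step] picks the next
   color so that these stay unbounded. *)
pose Q := fix Q m N := if m is m'.+1 then Q m' N /\ u N m' = step (m', Q m')
                       else True.
exists (fun m => step (m, Q m)) => m.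
have infQ : unbounded (Q m).
  elim: m => [|m IHm]; first by move=> M; exists M.
  exact: (stepP (m, Q m)).
have [N leN QN] := infQ m; exists N => // i.
elim: m QN {infQ leN} => [//|m IHm] /= [QN uN]; rewrite ltnS leq_eqVlt.
by case/predU1P=> [->|] //; exact: IHm.
Qed.

End Compactness.

Lemma r_regular_bounded (n r : nat) (a : 'I_n -> int) :
  r_regular r a ->
  exists N, forall c : nat -> 'I_r, exists x : 'I_n -> nat,
    (forall i, (0 < x i <= N)%N) /\ monochromatic c x /\ lform a x = 0.
Proof.
move=> reg; apply: contrapT => noN.
have /choice[u uP] N : exists c : nat -> 'I_r, ~ exists x : 'I_n -> nat,
    (forall i, (0 < x i <= N)%N) /\ monochromatic c x /\ lform a x = 0.
  by apply: contrapT => noc; apply: noN; exists N => c; apply: contrapT => nox;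
    apply: noc; exists c.
have [c cP] := coloring_compactness u.
have [x [x_gt0 [[col xcol] ax0]]] := reg c.
have le_max i : (x i <= \max_j x j)%N by apply: leq_bigmax.
have [N ltN uN] := cP (\max_j x j).+1.
apply: (uP N); exists x; split=> [i|].
  by rewrite x_gt0 (leq_trans (le_max i)) // ltnW.
by split=> //; exists col => i; rewrite uN ?xcol // ltnS.
Qed.

Section Dot.
Variable n : nat.
Implicit Types a u v : 'I_n -> int.

Definition dot a v : int := \sum_(i < n) a i * v i.

Lemma lformE a x : lform a x = dot a (fun i => (x i)%:Z).
Proof. by []. Qed.

Lemma dot_lin a u v p q :
  dot a (fun i => p * u i + q * v i) = p * dot a u + q * dot a v.
Proof.
rewrite /dot !mulr_sumr -big_split; apply: eq_bigr => i _ /=; ring.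
Qed.

End Dot.

(** Each of these nonzero affine functions of [t] has at most one root; pigeonhole over [k + 1]
    values. *)
Lemma avoid_affine_roots (k : nat) (p q : 'I_k -> int) :
  (forall j, p j != 0 \/ q j != 0) ->
  exists2 t, (t <= k)%N & forall j, p j + t%:Z * q j != 0.
Proof.
move=> pq; apply: contrapT => not.
have /choice[f fP] (t : 'I_k.+1) : exists j, p j + (t : nat)%:Z * q j = 0.
  apply: contrapT => noj; apply: not; exists (t : nat); first by rewrite -ltnS.
  by move=> j; apply/eqP => ?; apply: noj; exists j.
have /injectivePn[t [t' neq_tt' eq_f]] : ~~ injectiveb f.
  by apply/injectiveP => /leq_card; rewrite !card_ord ltnn.
have := fP t'; rewrite -eq_f => root'; have root := fP t.
have /eqP : ((t : nat)%:Z - (t' : nat)%:Z) * q (f t) = 0 by lia.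
rewrite mulf_eq0 subr_eq0 eqz_nat val_eqE (negPf neq_tt') /= => /eqP q0.
by case: (pq (f t)); rewrite ?q0 ?eqxx //; move: root; rewrite q0 mulr0 addr0 => ->.
Qed.

Lemma kernel_not_multiple n (a v : 'I_n -> int) : (forall i, a i != 0) ->
  ~ is_multiple v a -> exists u, dot a u = 0 /\ dot v u != 0.
Proof.
move=> a_neq0 not_mul; apply: contrapT => nou.
case: n a v a_neq0 not_mul nou => [|n] a v a_neq0 not_mul nou.
  by apply: not_mul; exists 0; case.
apply: not_mul; exists ((v ord0)%:~R / (a ord0)%:~R) => i.
(* These test vectors lie in the kernel of [a]; if [v] kills them all, it is proportional to [a]. *)
have dotE w : dot w (fun l => (l == i)%:Z * a ord0 - (l == ord0)%:Z * a i)
    = w i * a ord0 - w ord0 * a i.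
  rewrite /dot; under eq_bigr => l _ do rewrite mulrBr.
  rewrite big_split sumrN /= (bigD1 i) //= [X in _ - X](bigD1 ord0) //=.
  by rewrite !eqxx !mul1r !big1 ?addr0 // => l /negPf-> //; rewrite mul0r mulr0.
have vE : v i * a ord0 = v ord0 * a i.
  apply/eqP; rewrite -subr_eq0 -dotE; apply: contrapT => /negP dotv_neq0.
  by apply: nou; eexists; split; last exact: dotv_neq0; rewrite dotE; ring.
have a0_neq0 : (a ord0)%:~R != 0 :> rat by rewrite intr_eq0.
by rewrite mulrAC -intrM -vE intrM mulfK.
Qed.

(** By induction: a vector good for the later forms is moved along a kernel vector on which the
    first form is nonzero. *)
Lemma generic_kernel_vector n k (a : 'I_n -> int) (A : 'I_k -> 'I_n -> int) :
  (forall i, a i != 0) -> (forall j, ~ is_multiple (A j) a) ->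
  exists v, dot a v = 0 /\ forall j, dot (A j) v != 0.
Proof.
move=> a_neq0; elim: k A => [|k IHk] A not_mul.
  by exists (fun=> 0); split=> [|[]//]; rewrite /dot big1 // => i _; rewrite mulr0.
have [v [av Av]] := IHk (fun j => A (lift ord0 j)) (fun j => not_mul _).
have [u [au Au]] := kernel_not_multiple a_neq0 (not_mul ord0).
have [|t _ tP] := @avoid_affine_roots _ (fun j => dot (A j) v) (fun j => dot (A j) u).
  by move=> j; case: (unliftP ord0 j) => [l|] ->; [left|right].
exists (fun i => 1 * v i + t%:Z * u i); split=> [|j].
  by rewrite dot_lin av au !mulr0.
by rewrite dot_lin mul1r.
Qed.

Theorem theorem2 (n r : nat) (a : 'I_n -> int) :
  (forall i, a i != 0) ->
  r_regular r a ->
  forall (k : nat) (A : 'I_k -> 'I_n -> int),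
    (forall j, ~ is_multiple (A j) a) ->
    regular_sys r a A.
Proof.
move=> a_neq0 reg k A not_mul c.
have [N regN] := r_regular_bounded reg.
have [v [av Av]] := generic_kernel_vector a_neq0 not_mul.
(* Bounds every offset [s i] below, using [t <= k] and [N! / x i <= N!]. *)
pose L := (k * N`! * \sum_i `|v i|)%N.
have [M apM] := van_der_Waerden (2 * L) {ffun 'I_N.+1 -> 'I_r}.
(* The shift [m.+1] keeps the terms positive, as [b] may be 0. *)
have [b [e [e_gt0 _ be]]] :=
  apM (fun m => [ffun i : 'I_N.+1 => c (i * m.+1)%N]).
have [x [xN [[col xcol] ax]]] := regN (fun m => c (m * b.+1)%N).
(* The middle of the [2 * L + 1] terms [b + 1 + j * e], so that signed offsets up to [L] fit. *)
pose D : int := b%:Z + 1 + L%:Z * e%:Z.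
have [j|t le_tk tP] := @avoid_affine_roots k (fun j => D * lform (A j) x)
    (fun j => (e * N`!)%N%:Z * dot (A j) v).
  by right; rewrite mulf_neq0 // eqz_nat muln_eq0 negb_or -!lt0n e_gt0 fact_gt0.
pose s i : int := t%:Z * (N`! %/ x i)%N%:Z * v i.
have s_bound i : (`|s i| <= L)%N.
  rewrite !abszM !absz_nat /L leq_mul // ?leq_mul ?leq_div //.
  by rewrite (bigD1 i) //= leq_addr.
(* The offset [s i] counted from the first term instead of the middle. *)
clearbody L; pose m i := absz (L%:Z + s i).
have mE i : (m i)%:Z = L%:Z + s i by have := s_bound i; rewrite /m; lia.
pose y i := (x i * (b + m i * e).+1)%N.
have yE i : (y i)%:Z = D * (x i)%:Z + (t * e * N`!)%N%:Z * v i.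
  have /divnK NE : (x i %| N`!)%N by apply: dvdn_fact.
  rewrite /y /D /s -[in RHS]NE; rewrite PoszM -addn1 !PoszD !PoszM mE /s; ring.
have formE w : lform w y = D * lform w x + (t * e * N`!)%N%:Z * dot w v.
  by rewrite !lformE -dot_lin; apply: eq_bigr => i _; rewrite yE.
exists y; split; first by move=> i; rewrite muln_gt0; case/andP: (xN i) => ->.
split; [|split].
- exists col => i; rewrite -(xcol i).
  have lt_xN : (x i < N.+1)%N by case/andP: (xN i).
  have lt_m : (m i < (2 * L).+1)%N by have := s_bound i; rewrite /m; lia.
  by have /ffunP/(_ (Ordinal lt_xN)) := be _ lt_m; rewrite !ffunE.
- by rewrite formE ax av !mulr0.
- move=> j; apply/eqP; rewrite formE.
  by have := tP j; rewrite -mulnA PoszM mulrA.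
Qed.
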